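(* Let $(\mu_t,\phi_t)$ be a deformation of order $N$ of a LeibDer pair $(\mathfrak{g},\phi_\mathfrak{g})$. Then $(\mu_t,\phi_t)$ is extensible if and only if the obstruction class $[(\mathrm{Ob}^3,\mathrm{Ob}^2)]\in H^3_{\mathrm{LeibDer}}(\mathfrak{g},\mathfrak{g})$ vanishes.
   Context: All vector spaces and linear maps are over a field $\mathbb{K}$ of characteristic zero. A (right) Leibniz algebra is a vector space $\mathfrak{g}$ with a bilinear bracket satisfying $[[x,y],z]=[[x,z],y]+[x,[y,z]]$. A LeibDer pair $(\mathfrak{g},\phi_\mathfrak{g})$ is a Leibniz algebra with a derivation $\phi_\mathfrak{g}$ ($\phi_\mathfrak{g}[x,y]=[\phi_\mathfrak{g}(x),y]+[x,\phi_\mathfrak{g}(y)]$). Write $\mu(x,y)=[x,y]$. Cohomology with coefficients in itself: for $f\in\mathrm{Hom}(\mathfrak{g}^{\otimes n},\mathfrak{g})$, $$(\delta_Lf)(x_1,\ldots,x_{n+1})=[x_1,f(x_2,\ldots,x_{n+1})]+\sum_{i=2}^{n+1}(-1)^i[f(x_1,\ldots,\widehat{x_i},\ldots,x_{n+1}),x_i]+\sum_{i<j}(-1)^{j+1}f(x_1,\ldots,x_{i-1},[x_i,x_j],x_{i+1},\ldots,\widehat{x_j},\ldots,x_{n+1}),$$ $$\delta f=\sum_{i=1}^nf\circ(\mathrm{id}\otimes\cdots\otimes\phi_\mathfrak{g}\otimes\cdots\otimes\mathrm{id})-\phi_\mathfrak{g}\circ f\quad(\phi_\mathfrak{g}\text{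 in the }i\text{-th place}).$$ Put $C^0_{\mathrm{LeibDer}}=0$, $C^1_{\mathrm{LeibDer}}(\mathfrak{g},\mathfrak{g})=\mathrm{Hom}(\mathfrak{g},\mathfrak{g})$, $C^n_{\mathrm{LeibDer}}(\mathfrak{g},\mathfrak{g})=\mathrm{Hom}(\mathfrak{g}^{\otimes n},\mathfrak{g})\times\mathrm{Hom}(\mathfrak{g}^{\otimes n-1},\mathfrak{g})$ for $n\ge2$, with $\partial f=(\delta_Lf,-\delta f)$ on $C^1_{\mathrm{LeibDer}}$ and $\partial(f_n,\overline f_n)=(\delta_Lf_n,\delta_L\overline f_n+(-1)^n\delta f_n)$ for $n\ge2$. $H^n_{\mathrm{LeibDer}}(\mathfrak{g},\mathfrak{g})$ is the $n$-th cohomology. A deformation of order $N$ of $(\mathfrak{g},\phi_\mathfrak{g})$ consists of finite sums $\mu_t=\sum_{i=0}^Nt^i\mu_i$ ($\mu_i\in\mathrm{Hom}(\mathfrak{g}^{\otimes2},\mathfrak{g})$, $\mu_0=\mu$) and $\phi_t=\sum_{i=0}^Nt^i\phi_i$ ($\phi_i\in\mathrm{Hom}(\mathfrak{g},\mathfrak{g})$, $\phi_0=\phi_\mathfrak{g}$) such that $\mu_t$ defines a Leibniz bracket on $\mathfrak{g}[[t]]/(t^{N+1})$ and $\phi_t$ is a derivation on it. It is extensible if there is $(\mu_{N+1},\phi_{N+1})\in C^2_{\mathrm{LeibDer}}(\mathfrak{g},\mathfrak{g})$ such that $(\mu_t+t^{N+1}\mu_{N+1},\ \phi_t+t^{N+1}\phi_{N+1})$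 is a deformation of order $N+1$. The obstruction cocycle of the deformation is $$\mathrm{Ob}^3=\frac12\sum_{i+j=N+1,\ i,j>0}\llbracket\mu_i,\mu_j\rrbracket,\qquad \mathrm{Ob}^2=\sum_{i+j=N+1,\ i,j>0}\llbracket\phi_i,\mu_j\rrbracket,$$ where for $\alpha,\beta\in\mathrm{Hom}(\mathfrak{g}^{\otimes2},\mathfrak{g})$, $\varphi\in\mathrm{Hom}(\mathfrak{g},\mathfrak{g})$: $\llbracket\alpha,\beta\rrbracket=\alpha\bullet\beta+\beta\bullet\alpha$ with $(\alpha\bullet\beta)(x,y,z)=\alpha(\beta(x,y),z)-\alpha(\beta(x,z),y)-\alpha(x,\beta(y,z))$, and $\llbracket\varphi,\alpha\rrbracket(x,y)=\varphi(\alpha(x,y))-\alpha(\varphi(x),y)-\alpha(x,\varphi(y))$. The pair $(\mathrm{Ob}^3,\mathrm{Ob}^2)$ is a 3-cocycle in $C^3_{\mathrm{LeibDer}}(\mathfrak{g},\mathfrak{g})$; its class is the obstruction class. *)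

(* Defs.v *)
From HB Require Import structures.
From mathcomp Require Import all_boot all_order all_algebra.
From mathcomp Require Import ring_quotient boolp classical_sets functions.

Set Implicit Arguments.
Unset Strict Implicit.
Unset Printing Implicit Defensive.

Import GRing.Theory.
Local Open Scope ring_scope.

Section TupleSurgery.
Variable T : Type.

(* x with its i-th entry replaced by u *)
Definition tset n (i : 'I_n) (u : T) (x : n.-tuple T) : n.-tuple T :=
  [tuple if j == i then u else tnth x j | j < n].

(* x with its i-th entry omitted *)
Definition tdrop n (i : 'I_n.+1) (x : n.+1.-tuple T) : n.-tuple T :=
  [tuple tnth x (lift i j) | j < n].

Lemma tnth_tset n (i j : 'I_n) u x :
  tnth (tset i u x) j = if j == i then u else tnth x j.
Proof. by rewrite tnth_mktuple. Qed.

Lemma tdrop_tset n (i : 'I_n.+1) u x : tdrop i (tset i u x) = tdrop i x.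
Proof.
apply: eq_from_tnth => j; rewrite !tnth_mktuple.
by rewrite eq_sym (negbTE (neq_lift i j)).
Qed.

Lemma tdrop_tset_lift n (i : 'I_n.+1) k u x :
  tdrop i (tset (lift i k) u x) = tset k u (tdrop i x).
Proof.
apply: eq_from_tnth => j; rewrite !tnth_mktuple.
by rewrite (inj_eq (@lift_inj _ i)).
Qed.

Lemma tset_tset n (i : 'I_n) u v x : tset i u (tset i v x) = tset i u x.
Proof.
by apply: eq_from_tnth => j; rewrite !tnth_tset; case: eqP.
Qed.

Lemma tset_comm n (i j : 'I_n) u v x :
  i != j -> tset i u (tset j v x) = tset j v (tset i u x).
Proof.
move=> ij; apply: eq_from_tnth => k; rewrite !tnth_tset.
by case: (eqVneq k i) => [->|//]; rewrite (negbTE ij).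
Qed.

End TupleSurgery.

Section Multilinear.
Variables (K : fieldType) (g : lmodType K).

Definition multilinear n (f : n.-tuple g -> g) : Prop :=
  forall (i : 'I_n) (x : n.-tuple g) (a : K) (u v : g),
    f (tset i (a *: u + v) x) = a *: f (tset i u x) + f (tset i v x).

Definition multilinear_pred n : {pred (n.-tuple g -> g)} :=
  fun f => `[< multilinear f >].

Lemma multilinear_submod n : submod_closed (@multilinear_pred n).
Proof.
split.
  apply/asboolP => i x a u v.
  by have : 0 = a *: 0 + 0 :> g by rewrite scaler0 addr0.
move=> b f h /asboolP fP /asboolP hP; apply/asboolP => i x a u v.
rewrite !fctE fP hP !scalerDr !scalerA mulrC !addrA; congr (_ + _).
by rewrite -!addrA; congr (_ + _); rewrite addrC.
Qed.

HB.instance Definition _ n :=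
  GRing.isSubmodClosed.Build K (n.-tuple g -> g) (@multilinear_pred n)
    (multilinear_submod n).

(* Hom(g^{(x)n}, g), through the universal property of the tensor power. *)
Record mlin n := Mlin {
  mlin_fun :> n.-tuple g -> g;
  _ : mlin_fun \in @multilinear_pred n }.

HB.instance Definition _ n := [isSub for @mlin_fun n].
HB.instance Definition _ n := gen_eqMixin (mlin n).
HB.instance Definition _ n := gen_choiceMixin (mlin n).
HB.instance Definition _ n := [SubChoice_isSubLmodule of mlin n by <:].

Definition mkmlin n (f : n.-tuple g -> g) (fP : multilinear f) : mlin n :=
  Mlin (asboolT fP).

Lemma mlinP n (f : mlin n) : multilinear f.
Proof. by case: f => f /= /asboolP. Qed.

End Multilinear.

Section Cochains.
Variables (K : fieldType) (g : lmodType K).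
Local Notation mlin := (mlin g).

Definition app1 (f : mlin 1) (x : g) : g := f [tuple x].
Definition app2 (m : mlin 2) (x y : g) : g := m [tuple x; y].

Lemma tset1 (u v : g) : [tuple u] = tset ord0 u [tuple v].
Proof. by apply: eq_from_tnth => i; rewrite tnth_tset (ord1 i). Qed.

Lemma tset2l (u v w : g) : [tuple u; w] = tset ord0 u [tuple v; w].
Proof. by apply: eq_from_tnth => -[[|[|//]] i]; rewrite tnth_tset. Qed.

Lemma tset2r (u v w : g) : [tuple w; u] = tset ord_max u [tuple w; v].
Proof. by apply: eq_from_tnth => -[[|[|//]] i]; rewrite tnth_tset. Qed.

Lemma app1_linear (f : mlin 1) : linear (app1 f).
Proof.
by move=> a u v; rewrite /app1 (tset1 _ 0) mlinP -!tset1.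
Qed.

Lemma app2_linearl (m : mlin 2) (y : g) : linear (app2 m ^~ y).
Proof.
by move=> a u v; rewrite /app2 (tset2l _ 0) mlinP -!tset2l.
Qed.

Lemma app2_linearr (m : mlin 2) (x : g) : linear (app2 m x).
Proof.
by move=> a u v; rewrite /app2 (tset2r _ 0) mlinP -!tset2r.
Qed.

HB.instance Definition _ (f : mlin 1) :=
  GRing.isLinear.Build K g g *:%R (app1 f) (app1_linear f).
HB.instance Definition _ (m : mlin 2) (x : g) :=
  GRing.isLinear.Build K g g *:%R (app2 m x) (app2_linearr m x).

Lemma app2Dl m x y z : app2 m (x + y) z = app2 m x z + app2 m y z.
Proof. by have := app2_linearl m z 1 x y; rewrite !scale1r. Qed.

Lemma app2Zl m a x z : app2 m (a *: x) z = a *: app2 m x z.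
Proof.
have /(_ 0 0) := app2_linearl m z 0; rewrite !scale0r !add0r => m0.
have := app2_linearl m z a x 0; rewrite addr0.
suff -> : app2 m 0 z = 0 by rewrite addr0.
by have := app2_linearl m z (-1) 0 0; rewrite !scaleN1r !addNr.
Qed.

Section Differentials.
Variables (mu : mlin 2) (phi : mlin 1).
Local Notation "[| x , y |]" := (app2 mu x y) (format "[| x ,  y |]").

(* x : n.+1.-tuple g is indexed from 0, so that tnth x i is the paper's
   x_{i+1}; this shifts the parity of the signs by one. *)
Definition deltaL_fun n (f : mlin n) (x : n.+1.-tuple g) : g :=
  [| tnth x ord0, f (tdrop ord0 x) |]
  + \sum_(i < n.+1 | (0 < i)%N)
      (-1) ^+ i.+1 *: [| f (tdrop i x), tnth x i |]
  + \sum_(j < n.+1) \sum_(i < n.+1 | (i < j)%N)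
      (-1) ^+ j *: f (tdrop j (tset i [| tnth x i, tnth x j |] x)).

Lemma deltaL_multilinear n (f : mlin n) : multilinear (deltaL_fun f).
Proof.
apply/asboolP.
have brP a (F : n.+1.-tuple g -> g) :
    multilinear F -> (fun x => a *: F x) \in @multilinear_pred K g n.+1.
  by move=> FP; apply: (@rpredZ _ _ _ a F); apply/asboolP.
have sumP (I : finType) (P : pred I) (F : I -> n.+1.-tuple g -> g) :
    (forall i, P i -> F i \in @multilinear_pred K g n.+1) ->
    (fun x => \sum_(i | P i) F i x) \in @multilinear_pred K g n.+1.
  move=> FP; have -> : (fun x => \sum_(i | P i) F i x) = \sum_(i | P i) F i.
    by rewrite fct_sumE.
  exact: rpred_sum.
have T2 (i : 'I_n.+1) : multilinear (fun x => [| f (tdrop i x), tnth x i |]).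
  move=> k x a u v; rewrite !tnth_tset.
  case: (unliftP i k) => [j ->|->].
    by rewrite (negbTE (neq_lift i j)) !tdrop_tset_lift mlinP app2Dl app2Zl.
  by rewrite eqxx !tdrop_tset linearP.
have T1 : multilinear (fun x => [| tnth x ord0, f (tdrop ord0 x) |]).
  move=> k x a u v; rewrite !tnth_tset.
  case: (unliftP ord0 k) => [j ->|->].
    by rewrite (negbTE (neq_lift ord0 j)) !tdrop_tset_lift mlinP linearP.
  by rewrite eqxx !tdrop_tset app2Dl app2Zl.
have T3 (i j : 'I_n.+1) : (i < j)%N -> multilinear
    (fun x => f (tdrop j (tset i [| tnth x i, tnth x j |] x))).
  move=> ij; have jNi : j != i by rewrite neq_ltn ij orbT.
  move=> k x a u v; rewrite !tnth_tset.
  case: (unliftP j i) jNi => [i' ->|->]; last by rewrite eqxx.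
  move=> _; rewrite !tdrop_tset_lift.
  case: (unliftP j k) => [k' ->|->].
    rewrite (negbTE (neq_lift j k')) !tdrop_tset_lift (inj_eq (@lift_inj _ j)).
    have [<-|ik] := eqVneq i' k'.
      by rewrite !tset_tset app2Dl app2Zl mlinP.
    by rewrite !(tset_comm _ _ _ ik) mlinP.
  rewrite eqxx (eq_sym _ j) (negbTE (neq_lift j i')) !tdrop_tset.
  by rewrite linearP mlinP.
have plusP (F G : n.+1.-tuple g -> g) :
   F \in @multilinear_pred K g n.+1 -> G \in @multilinear_pred K g n.+1 ->
   (fun x => F x + G x) \in @multilinear_pred K g n.+1 by exact: rpredD.
apply: (plusP); first apply: (plusP).
- by apply/asboolP.
- by apply: (sumP) => i _; apply: brP; apply: T2.
- by apply: (sumP) => j _; apply: (sumP) => i ij; apply: brP; apply: T3.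
Qed.

Definition deltaL n (f : mlin n) : mlin n.+1 := mkmlin (deltaL_multilinear f).

Definition delta_fun n (f : mlin n) (x : n.-tuple g) : g :=
  \sum_(i < n) f (tset i (app1 phi (tnth x i)) x) - app1 phi (f x).

Lemma delta_multilinear n (f : mlin n) : multilinear (delta_fun f).
Proof.
move=> k x a u v; rewrite /delta_fun mlinP linearP opprD scalerBr.
rewrite [RHS]addrACA -scalerN; congr (_ + _).
rewrite scaler_sumr -big_split; apply: eq_bigr => i _ /=; rewrite !tnth_tset.
have [->|ik] := eqVneq i k; first by rewrite !tset_tset linearP mlinP.
by rewrite !(tset_comm _ _ _ ik) mlinP.
Qed.

Definition delta n (f : mlin n) : mlin n := mkmlin (delta_multilinear f).

Lemma mlinE n a (f h : mlin n) x : (a *: f + h) x = a *: f x + h x.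
Proof. by []. Qed.

Lemma deltaL_linear n : linear (@deltaL n).
Proof.
move=> a f h; apply/val_inj/funext => x.
rewrite [RHS]mlinE /= /deltaL_fun !mlinE linearP /=.
rewrite !scalerDr !scaler_sumr.
rewrite [RHS]addrACA [in RHS](addrACA (a *: _)); congr (_ + _ + _).
  rewrite -big_split; apply: eq_bigr => i _ /=.
  rewrite -[X in app2 mu X _]/(a *: f (tdrop i x) + h (tdrop i x)).
  by rewrite app2Dl app2Zl scalerDr !scalerA mulrC.
rewrite -big_split; apply: eq_bigr => j _ /=.
rewrite scaler_sumr -big_split; apply: eq_bigr => i _ /=.
set y := tdrop j _; rewrite -[X in _ *: X = _]/(a *: f y + h y).
by rewrite scalerDr !scalerA mulrC.
Qed.

Lemma delta_linear n : linear (@delta n).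
Proof.
move=> a f h; apply/val_inj/funext => x.
rewrite [RHS]mlinE /= /delta_fun !mlinE linearP opprD scalerBr.
rewrite [RHS]addrACA -scalerN; congr (_ + _).
by rewrite scaler_sumr -big_split.
Qed.

HB.instance Definition _ n :=
  GRing.isLinear.Build K (mlin n) (mlin n.+1) *:%R (@deltaL n)
    (@deltaL_linear n).
HB.instance Definition _ n :=
  GRing.isLinear.Build K (mlin n) (mlin n) *:%R (@delta n) (@delta_linear n).

End Differentials.
End Cochains.

Section Identities.
Variable V : zmodType.

(* Right Leibniz identity. *)
Definition leibniz (br : V -> V -> V) : Prop :=
  forall x y z, br (br x y) z = br (br x z) y + br x (br y z).

Definition derivation (br : V -> V -> V) (d : V -> V) : Prop :=
  forall x y, d (br x y) = br (d x) y + br x (d y).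

End Identities.

Record leibDerPair (K : fieldType) (g : lmodType K) := LeibDerPair {
  bracket : mlin g 2;
  der : mlin g 1;
  bracket_leibniz : leibniz (app2 bracket);
  der_derivation : derivation (app2 bracket) (app1 der) }.

Section Cohomology.
Variables (K : fieldType) (g : lmodType K) (A : leibDerPair g).

(* 'rV[K]_0 is the zero space. *)
Definition cochain n : lmodType K :=
  match n with
  | 0 => 'rV[K]_0
  | 1 => mlin g 1
  | n.+2 => (mlin g n.+2 * mlin g n.+1)%type
  end.

Local Notation dL := (deltaL (bracket A)).
Local Notation dphi := (delta (der A)).

Definition pd n : cochain n -> cochain n.+1 :=
  match n return cochain n -> cochain n.+1 with
  | 0 => fun=> 0
  | 1 => fun f => (dL f, - dphi f)
  | n.+2 => fun f => (dL f.1, dL f.2 + (-1) ^+ n.+2 *: dphi f.1)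
  end.

Lemma pd_linear n : linear (@pd n).
Proof.
case: n => [|[|n]] a f h /=.
- by rewrite scaler0 addr0.
- by congr (_, _); rewrite linearP //= opprD -scalerN.
- congr (_, _); rewrite linearP //= linearP /= !scalerDr addrACA.
  by rewrite !scalerA mulrC.
Qed.

Definition cocycle_pred n : {pred cochain n} := fun c => pd c == 0.

Lemma cocycle_submod n : submod_closed (@cocycle_pred n).
Proof.
have pd0 : pd (0 : cochain n) = 0.
  by have := @pd_linear n (-1) 0 0; rewrite !scaleN1r !addNr.
split; first by apply/eqP.
move=> a f h /eqP f0 /eqP h0; apply/eqP.
by rewrite pd_linear f0 h0 scaler0 addr0.
Qed.

HB.instance Definition _ n :=
  GRing.isSubmodClosed.Build K (cochain n) (@cocycle_pred n)
    (@cocycle_submod n).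

Record cocycle n := Cocycle {
  cocycle_val :> cochain n;
  _ : cocycle_val \in @cocycle_pred n }.

HB.instance Definition _ n := [isSub for @cocycle_val n].
HB.instance Definition _ n := [Choice of cocycle n by <:].
HB.instance Definition _ n := [SubChoice_isSubLmodule of cocycle n by <:].

Definition is_coboundary n : cochain n -> Prop :=
  match n return cochain n -> Prop with
  | 0 => fun c => c = 0
  | n.+1 => fun c => exists b : cochain n, pd b = c
  end.

Definition coboundary n : {pred cocycle n} :=
  fun c => `[< is_coboundary (cocycle_val c) >].

Lemma coboundary_submod n : submod_closed (@coboundary n).
Proof.
case: n => [|n]; split.
- by apply/asboolP.
- move=> a f h /asboolP /= f0 /asboolP /= h0; apply/asboolP => /=.
  by rewrite f0 h0 scaler0 addr0.
- apply/asboolP; exists 0.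
  by have := @pd_linear n (-1) 0 0; rewrite !scaleN1r !addNr.
- move=> a f h /asboolP[b bf] /asboolP[c ch]; apply/asboolP.
  by exists (a *: b + c); rewrite pd_linear bf ch.
Qed.

HB.instance Definition _ n :=
  GRing.isSubmodClosed.Build K (cocycle n) (@coboundary n)
    (@coboundary_submod n).

(* Cocycles modulo coboundaries, as an additive group. *)
Definition cohomology n : zmodType := Quotient.quot (@coboundary n).

Definition cohom_class n (c : cocycle n) : cohomology n :=
  (\pi_(Quotient.quot (@coboundary n)) c)%qT.

End Cohomology.

Section Deformations.
Variables (K : fieldType) (g : lmodType K).
Local Notation mlin := (mlin g).

(* V[[t]]/(t^{N+1}), the truncated series sum_{i <= N} t^i x_i being the family
   of its coefficients. *)
Definition trunc N (V : Type) := {ffun 'I_N.+1 -> V}.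

HB.instance Definition _ N (V : zmodType) := GRing.Zmodule.on (trunc N V).

Section Evaluation.
Variable N : nat.

(* K[[t]]/(t^{N+1})-(bi)linear extensions of mu_t and phi_t. *)
Definition tbracket (mu : trunc N (mlin 2)) (x y : trunc N g) : trunc N g :=
  [ffun k : 'I_N.+1 => \sum_(a < N.+1) \sum_(b < N.+1)
     \sum_(c < N.+1 | (a + b + c == k)%N) app2 (mu a) (x b) (y c)].

Definition tder (phi : trunc N (mlin 1)) (x : trunc N g) : trunc N g :=
  [ffun k : 'I_N.+1 => \sum_(a < N.+1)
     \sum_(b < N.+1 | (a + b == k)%N) app1 (phi a) (x b)].

End Evaluation.

Definition is_deformation (A : leibDerPair g) N
    (mu : trunc N (mlin 2)) (phi : trunc N (mlin 1)) : Prop :=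
  [/\ mu ord0 = bracket A, phi ord0 = der A,
      leibniz (tbracket mu) & derivation (tbracket mu) (tder phi)].

Record deformation (A : leibDerPair g) N := Deformation {
  mut : trunc N (mlin 2);
  phit : trunc N (mlin 1);
  deformationP : is_deformation A mut phit }.

(* x + t^{N+1} v *)
Definition textend N (V : Type) (x : trunc N V) (v : V) : trunc N.+1 V :=
  [ffun k : 'I_N.+2 => if unlift ord_max k is Some i then x i else v].

Definition extensible (A : leibDerPair g) N (D : deformation A N) : Prop :=
  exists c : cochain g 2,
    is_deformation A (textend (mut D) c.1) (textend (phit D) c.2).

Lemma nth_tset n (i : 'I_n) u (x : n.-tuple g) k : (k < n)%N ->
  (tset i u x)`_k = if k == i then u else x`_k.
Proof.
move=> kn; rewrite -[k]/(val (Ordinal kn)) -!tnth_nth tnth_tset //.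
Qed.

Definition circ_at (a b : mlin 2) (x y z : g) : g :=
  app2 a (app2 b x y) z - app2 a (app2 b x z) y - app2 a x (app2 b y z).

(* alpha \bullet beta *)
Definition circ_fun (a b : mlin 2) (t : 3.-tuple g) : g :=
  circ_at a b t`_0 t`_1 t`_2.

Lemma addrBB (V : zmodType) (x y z x' y' z' : V) :
  (x + x') - (y + y') - (z + z') = (x - y - z) + (x' - y' - z').
Proof. by rewrite !opprD (addrACA x) (addrACA (x - y)). Qed.

Lemma circ_multilinear a b : multilinear (circ_fun a b).
Proof.
move=> i x s u v; rewrite /circ_fun /circ_at !nth_tset //.
rewrite !scalerBr -addrBB.
by case: i => -[|[|[|//]]] /= _;
  rewrite ?(linearP, app2Dl, app2Zl) /= ?(linearP, app2Dl, app2Zl).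
Qed.

Definition circ (a b : mlin 2) : mlin 3 := mkmlin (circ_multilinear a b).

Definition brak22 (a b : mlin 2) : mlin 3 := circ a b + circ b a.

Definition brak12_at (p : mlin 1) (a : mlin 2) (x y : g) : g :=
  app1 p (app2 a x y) - app2 a (app1 p x) y - app2 a x (app1 p y).

Definition brak12_fun (p : mlin 1) (a : mlin 2) (t : 2.-tuple g) : g :=
  brak12_at p a t`_0 t`_1.

Lemma brak12_multilinear p a : multilinear (brak12_fun p a).
Proof.
move=> i x s u v; rewrite /brak12_fun /brak12_at !nth_tset //.
rewrite !scalerBr -addrBB.
by case: i => -[|[|//]] /= _;
  rewrite ?(linearP, app2Dl, app2Zl) /= ?(linearP, app2Dl, app2Zl).
Qed.

Definition brak12 (p : mlin 1) (a : mlin 2) : mlin 2 :=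
  mkmlin (brak12_multilinear p a).

Section Obstruction.
Variables (A : leibDerPair g) (N : nat) (D : deformation A N).

(* Indices in 'I_N.+1 suffice: i + j = N.+1 and i, j > 0 force i, j <= N. *)
Definition Ob3 : mlin 3 :=
  2^-1 *: \sum_(i < N.+1)
    \sum_(j < N.+1 | [&& (i + j == N.+1)%N, (0 < i)%N & (0 < j)%N])
      brak22 (mut D i) (mut D j).

Definition Ob2 : mlin 2 :=
  \sum_(i < N.+1)
    \sum_(j < N.+1 | [&& (i + j == N.+1)%N, (0 < i)%N & (0 < j)%N])
      brak12 (phit D i) (mut D j).

Definition Ob : cochain g 3 := (Ob3, Ob2).

End Obstruction.

Definition deltaL2 (m : mlin 2) (f : g -> g -> g) (x y z : g) : g :=
  app2 m x (f y z) + app2 m (f x z) y - app2 m (f x y) z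
  - f (app2 m x y) z + f (app2 m x z) y + f x (app2 m y z).

Definition deltaL3 (m : mlin 2) (f : g -> g -> g -> g) (x y z w : g) : g :=
  app2 m x (f y z w) + app2 m (f x z w) y - app2 m (f x y w) z
  + app2 m (f x y z) w
  - f (app2 m x y) z w + f (app2 m x z) y w + f x (app2 m y z) w
  - f (app2 m x w) y z - f x (app2 m y w) z - f x y (app2 m z w).

Definition delta3 (p : mlin 1) (f : g -> g -> g -> g) (x y z : g) : g :=
  f (app1 p x) y z + f x (app1 p y) z + f x y (app1 p z) - app1 p (f x y z).

Lemma tdrop2E (i : 'I_3) (t : 3.-tuple g) :
  tdrop i t = [tuple tnth t (lift i ord0); tnth t (lift i ord_max)].
Proof.
apply: eq_from_tnth => -[[|[|//]] j]; rewrite tnth_mktuple;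
  by congr (tnth t (lift i _)); apply: val_inj.
Qed.

Lemma tdrop3E (i : 'I_4) (t : 4.-tuple g) :
  tdrop i t =
  [tuple tnth t (lift i ord0); tnth t (lift i (lift ord0 ord0));
         tnth t (lift i ord_max)].
Proof.
apply: eq_from_tnth => -[[|[|[|//]]] j]; rewrite tnth_mktuple;
  by congr (tnth t (lift i _)); apply: val_inj.
Qed.

Lemma tuple3E (t : 3.-tuple g) : t = [tuple t`_0; t`_1; t`_2].
Proof. by apply: eq_from_tnth => -[[|[|[|//]]] j]; rewrite (tnth_nth 0). Qed.

Lemma tuple4E (t : 4.-tuple g) : t = [tuple t`_0; t`_1; t`_2; t`_3].
Proof. by apply: eq_from_tnth => -[[|[|[|[|//]]]] j]; rewrite (tnth_nth 0). Qed.

Lemma tset3E (i : 'I_3) u (t : 3.-tuple g) :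
  tset i u t = [tuple if 0%N == i then u else t`_0;
    if 1%N == i then u else t`_1; if 2%N == i then u else t`_2].
Proof. by rewrite [LHS]tuple3E; congr [tuple _; _; _]; rewrite nth_tset. Qed.

Lemma signsE : ((-1) ^+ 1 = -1 :> K) * ((-1) ^+ 2 = 1 :> K)
  * ((-1) ^+ 3 = -1 :> K) * ((-1) ^+ 4 = 1 :> K).
Proof. by do 3?split; rewrite !exprS expr0 ?mulN1r ?opprK. Qed.

Lemma deltaLE2 (m : mlin 2) (f : mlin 2) x y z :
  deltaL m f [tuple x; y; z]
  = deltaL2 m (fun x y => f [tuple x; y]) x y z.
Proof.
rewrite /= /deltaL_fun /deltaL2 !big_mkcond /=.
do !rewrite ?[\sum_(i < 3 | _) _]big_mkcond ?big_ord_recl ?big_ord0 /=.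
rewrite !tdrop2E !tnth_tset !(tnth_nth 0) /= /bump /= !signsE.
rewrite !scaleN1r !scale1r !add0r !addr0 !addrA.
by [].
Qed.

Lemma deltaLE3 (m : mlin 2) (f : mlin 3) x y z w :
  deltaL m f [tuple x; y; z; w]
  = deltaL3 m (fun x y z => f [tuple x; y; z]) x y z w.
Proof.
rewrite /= /deltaL_fun /deltaL3 !big_mkcond /=.
do !rewrite ?[\sum_(i < 4 | _) _]big_mkcond ?big_ord_recl ?big_ord0 /=.
rewrite !tdrop3E !tnth_tset !(tnth_nth 0) /= /bump /= !signsE.
rewrite !scaleN1r !scale1r !add0r !addr0 !addrA.
by [].
Qed.

Lemma deltaE3 (p : mlin 1) (f : mlin 3) x y z :
  delta p f [tuple x; y; z]
  = delta3 p (fun x y z => f [tuple x; y; z]) x y z.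
Proof.
rewrite /= /delta_fun /delta3 !big_ord_recl big_ord0 /=.
by rewrite !tset3E !(tnth_nth 0) /= /bump /= addr0 !addrA.
Qed.

Lemma app2Nl (m : mlin 2) x z : app2 m (- x) z = - app2 m x z.
Proof. by rewrite -scaleN1r app2Zl scaleN1r. Qed.

Lemma app2_suml (m : mlin 2) I r (P : pred I) (F : I -> g) z :
  app2 m (\sum_(i <- r | P i) F i) z = \sum_(i <- r | P i) app2 m (F i) z.
Proof.
apply: (big_morph (app2 m ^~ z)) => [x y|]; first exact: app2Dl.
by have := app2Zl m 0 0 z; rewrite !scale0r.
Qed.

Lemma deltaL2_sum (m : mlin 2) I r (P : pred I) (F : I -> g -> g -> g) x y z :
  deltaL2 m (fun x y => \sum_(i <- r | P i) F i x y) x y z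
  = \sum_(i <- r | P i) deltaL2 m (F i) x y z.
Proof.
rewrite /deltaL2 !app2_suml linear_sum /=.
by rewrite -!sumrN -!big_split.
Qed.

Lemma deltaL3_sum (m : mlin 2) I r (P : pred I)
    (F : I -> g -> g -> g -> g) x y z w :
  deltaL3 m (fun x y z => \sum_(i <- r | P i) F i x y z) x y z w
  = \sum_(i <- r | P i) deltaL3 m (F i) x y z w.
Proof.
rewrite /deltaL3 !app2_suml linear_sum /=.
by rewrite -!sumrN -!big_split.
Qed.

Lemma delta3_sum (p : mlin 1) I r (P : pred I)
    (F : I -> g -> g -> g -> g) x y z :
  delta3 p (fun x y z => \sum_(i <- r | P i) F i x y z) x y z
  = \sum_(i <- r | P i) delta3 p (F i) x y z.
Proof.
rewrite /delta3 linear_sum /=.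
by rewrite -!sumrN -!big_split.
Qed.

Ltac expand2 :=
  rewrite ?(raddfD, raddfN, app2Dl, app2Nl, opprD, opprK) /=
          ?(raddfD, raddfN, app2Dl, app2Nl, opprD, opprK) /= -?addrA.

(* Cancels opposite terms in a sum. *)
Ltac cancel_all :=
  rewrite -[LHS]addr0 -?addrA;
  repeat match goal with
  | |- 0 = 0 => reflexivity
  | |- - ?t + _ = 0 => rewrite ?(addrCA _ t) addNKr
  | |- ?t + _ = 0 => rewrite ?(addrCA _ (- t)) addKr
  end.

Section TripleSums.
Variables (M n : nat).
Implicit Types F : 'I_M -> 'I_M -> 'I_M -> g.

Definition S3 F : g :=
  \sum_(a < M) \sum_(b < M) \sum_(c < M | (a + b + c == n)%N) F a b c.

Lemma S3_swap12 F : S3 F = S3 (fun a b c => F b a c).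
Proof.
rewrite /S3 exchange_big; apply: eq_bigr => b _; apply: eq_bigr => a _ /=.
by apply: eq_bigl => c; rewrite (addnC a).
Qed.

Lemma S3_swap23 F : S3 F = S3 (fun a b c => F a c b).
Proof.
rewrite /S3; apply: eq_bigr => a _; rewrite (exchange_big_dep xpredT) //=.
by apply: eq_bigr => c _; apply: eq_bigl => b; rewrite addnAC.
Qed.

Lemma S3D F G : S3 (fun a b c => F a b c + G a b c) = S3 F + S3 G.
Proof.
by rewrite /S3 -big_split; apply: eq_bigr => a _; rewrite -big_split;
   apply: eq_bigr => b _; rewrite -big_split.
Qed.

Lemma S3_eq0 F : (forall a b c, F a b c = 0) -> S3 F = 0.
Proof.
by move=> F0; rewrite /S3 big1 // => a _; rewrite big1 // => b _; rewrite big1.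
Qed.

Variables (m : 'I_M -> mlin 2) (p : 'I_M -> mlin 1).

(* The terms of deltaL3 (m a) (circ_at (m b) (m c)), sorted by the shape of the
   bracketing and named from the outermost operation inwards, so that they
   cancel once the summation indices are permuted. *)
Let nest (u v w : 'I_M) (x1 x2 x3 x4 : g) :=
    app2 (m u) x1 (circ_at (m v) (m w) x2 x3 x4)
  + app2 (m u) (circ_at (m v) (m w) x1 x3 x4) x2
  - app2 (m u) (circ_at (m v) (m w) x1 x2 x4) x3
  + app2 (m u) (circ_at (m v) (m w) x1 x2 x3) x4.

Let comb (u v w : 'I_M) (x1 x2 x3 x4 : g) :=
  - app2 (m u) (app2 (m v) (app2 (m w) x1 x2) x3) x4
  + app2 (m u) (app2 (m v) (app2 (m w) x1 x2) x4) x3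
  + app2 (m u) (app2 (m v) (app2 (m w) x1 x3) x2) x4
  - app2 (m u) (app2 (m v) (app2 (m w) x1 x3) x4) x2
  + app2 (m u) (app2 (m v) x1 (app2 (m w) x2 x3)) x4
  - app2 (m u) x1 (app2 (m v) (app2 (m w) x2 x3) x4)
  - app2 (m u) (app2 (m v) (app2 (m w) x1 x4) x2) x3
  + app2 (m u) (app2 (m v) (app2 (m w) x1 x4) x3) x2
  - app2 (m u) (app2 (m v) x1 (app2 (m w) x2 x4)) x3
  + app2 (m u) x1 (app2 (m v) (app2 (m w) x2 x4) x3)
  + app2 (m u) (app2 (m v) x1 (app2 (m w) x3 x4)) x2
  + app2 (m u) x1 (app2 (m v) x2 (app2 (m w) x3 x4)).

Let bal (u v w : 'I_M) (x1 x2 x3 x4 : g) :=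
    app2 (m u) (app2 (m v) x1 x2) (app2 (m w) x3 x4)
  - app2 (m u) (app2 (m v) x1 x3) (app2 (m w) x2 x4)
  + app2 (m u) (app2 (m v) x1 x4) (app2 (m w) x2 x3).

Lemma S3_deltaL3 x1 x2 x3 x4 :
  S3 (fun a b c => deltaL3 (m a) (circ_at (m b) (m c)) x1 x2 x3 x4) = 0.
Proof.
transitivity (S3 (fun a b c =>
   nest a b c x1 x2 x3 x4 + comb b c a x1 x2 x3 x4
   + (bal b a c x1 x2 x3 x4 - bal b c a x1 x2 x3 x4))).
  rewrite /S3; do 3 (apply: eq_bigr => ? _).
  apply/eqP; rewrite -subr_eq0; apply/eqP.
  rewrite /deltaL3 /nest /comb /bal /circ_at; expand2.
  by cancel_all.
rewrite S3D [X in X + _]S3D [X in _ + X]S3D.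
have -> : S3 (fun a b c => comb b c a x1 x2 x3 x4)
        = S3 (fun a b c => comb a b c x1 x2 x3 x4).
  by rewrite S3_swap12 S3_swap23.
rewrite [X in _ + (X + _)]S3_swap12 [X in _ + (_ + X)]S3_swap12.
rewrite [X in _ + (_ + X)]S3_swap23.
rewrite -!S3D; apply: S3_eq0 => a b c.
rewrite /nest /comb /bal /circ_at; expand2; cancel_all.
Qed.

Let inner (a b c : 'I_M) (x1 x2 x3 : g) :=
    app2 (m c) x1 (brak12_at (p a) (m b) x2 x3)
  + app2 (m c) (brak12_at (p a) (m b) x1 x3) x2
  - app2 (m c) (brak12_at (p a) (m b) x1 x2) x3.

Let outer (a b c : 'I_M) (x1 x2 x3 : g) :=
  - brak12_at (p a) (m b) (app2 (m c) x1 x2) x3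
  + brak12_at (p a) (m b) (app2 (m c) x1 x3) x2
  + brak12_at (p a) (m b) x1 (app2 (m c) x2 x3)
  - delta3 (p a) (circ_at (m b) (m c)) x1 x2 x3.

Lemma S3_deltaL2 x1 x2 x3 :
  S3 (fun a b c => deltaL2 (m c) (brak12_at (p a) (m b)) x1 x2 x3
                   - delta3 (p a) (circ_at (m b) (m c)) x1 x2 x3) = 0.
Proof.
transitivity (S3 (fun a b c => inner a b c x1 x2 x3 + outer a b c x1 x2 x3)).
  by rewrite /S3; do 3 (apply: eq_bigr => ? _); rewrite /deltaL2 /inner /outer !addrA.
rewrite S3D [X in X + _]S3_swap23 -S3D; apply: S3_eq0 => a b c.
by rewrite /inner /outer /brak12_at /delta3 /circ_at; expand2; cancel_all.
Qed.

End TripleSums.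

Section ObstructionCocycle.
Variables (A : leibDerPair g) (N : nat) (D : deformation A N).
Local Notation m := (mut D).
Local Notation p := (phit D).

Let tcst (x : g) : trunc N g := [ffun i => if i == ord0 then x else 0].

Let sum_tcst (F : 'I_N.+1 -> g -> g) y l k : (forall c, F c 0 = 0) ->
  \sum_(c < N.+1 | (l + c == k)%N) F c (tcst y c)
  = if (l == k)%N then F ord0 y else 0.
Proof.
move=> F0; rewrite big_mkcond (bigD1 ord0) //= ffunE eqxx addn0.
rewrite big1 ?addr0 // => c /negbTE c0.
by rewrite ffunE c0 F0 if_same.
Qed.

Let app20l (a : mlin 2) z : app2 a 0 z = 0.
Proof. by have := app2Zl a 0 0 z; rewrite !scale0r. Qed.

Let tbracket_cstr (X : trunc N g) y : tbracket m X (tcst y) =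
  [ffun k : 'I_N.+1 =>
     \sum_(a < N.+1) \sum_(b < N.+1 | (a + b == k)%N) app2 (m a) (X b) y].
Proof.
apply/ffunP => k; rewrite !ffunE; apply: eq_bigr => a _.
rewrite [RHS]big_mkcond; apply: eq_bigr => b _.
by rewrite (sum_tcst (F := fun c => app2 (m a) (X b))) // => _; rewrite raddf0.
Qed.

Let tbracket_cstl x (Y : trunc N g) : tbracket m (tcst x) Y =
  [ffun k : 'I_N.+1 =>
     \sum_(a < N.+1) \sum_(b < N.+1 | (a + b == k)%N) app2 (m a) x (Y b)].
Proof.
apply/ffunP => k; rewrite !ffunE; apply: eq_bigr => a _.
rewrite (exchange_big_dep xpredT) //= [RHS]big_mkcond; apply: eq_bigr => b _.
under eq_bigl => c do rewrite addnAC.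
by rewrite (sum_tcst (F := fun c u => app2 (m a) u (Y b))).
Qed.

Let sum_diag (F : 'I_N.+1 -> g) (k : 'I_N.+1) :
  \sum_(a < N.+1) (if (a == k :> nat)%N then F a else 0) = F k.
Proof. by rewrite -big_mkcond (big_pred1 k). Qed.

Let tbracket_cst x y : tbracket m (tcst x) (tcst y) =
  [ffun a : 'I_N.+1 => app2 (m a) x y].
Proof.
apply/ffunP => k; rewrite tbracket_cstr !ffunE -[RHS](sum_diag (fun a => app2 (m a) x y)).
apply: eq_bigr => a _.
by rewrite (sum_tcst (F := fun c u => app2 (m a) u y)).
Qed.

Let tder_cst x : tder p (tcst x) = [ffun a : 'I_N.+1 => app1 (p a) x].
Proof.
apply/ffunP => k; rewrite !ffunE -[RHS](sum_diag (fun a => app1 (p a) x)).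
apply: eq_bigr => a _.
by rewrite (sum_tcst (F := fun c => app1 (p a))) // => _; rewrite raddf0.
Qed.

Let leibniz_coef k x y z : (k < N.+1)%N ->
  \sum_(a < N.+1) \sum_(b < N.+1 | (a + b == k)%N) circ_at (m a) (m b) x y z = 0.
Proof.
case: (deformationP D) => _ _ /(_ (tcst x) (tcst y) (tcst z)) + _ kN.
move=> /ffunP/(_ (Ordinal kN)).
rewrite !tbracket_cst !tbracket_cstr tbracket_cstl [in RHS]ffunE !ffunE /=.
move=> /eqP; rewrite -subr_eq0 opprD addrA => /eqP E; apply: etrans E.
rewrite -!sumrB; apply: eq_bigr => a _.
by rewrite -!sumrB; apply: eq_bigr => b _; rewrite !ffunE.
Qed.

Let derivation_coef k x y : (k < N.+1)%N ->
  \sum_(a < N.+1) \sum_(b < N.+1 | (a + b == k)%N) brak12_at (p a) (m b) x y = 0.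
Proof.
case: (deformationP D) => _ _ _ /(_ (tcst x) (tcst y)) + kN.
move=> /ffunP/(_ (Ordinal kN)).
rewrite !tder_cst !tbracket_cst !tbracket_cstr tbracket_cstl.
rewrite [in RHS]ffunE !ffunE /=.
move=> /eqP; rewrite -subr_eq0 opprD addrA => /eqP E; apply: etrans E.
have sw (F : 'I_N.+1 -> 'I_N.+1 -> g) :
    \sum_(a < N.+1) \sum_(b < N.+1 | (a + b == k)%N) F a b =
    \sum_(a < N.+1) \sum_(b < N.+1 | (a + b == k)%N) F b a.
  rewrite (exchange_big_dep xpredT) //=; apply: eq_bigr => a _.
  by apply: eq_bigl => b; rewrite addnC.
rewrite [X in _ - X - _]sw [X in _ - _ - X]sw.
rewrite -!sumrB; apply: eq_bigr => a _.
by rewrite -!sumrB; apply: eq_bigr => b _; rewrite !ffunE.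
Qed.

Let sum_pos (V : zmodType) (F : 'I_N.+1 -> 'I_N.+1 -> V) :
  \sum_(i < N.+1)
    \sum_(j < N.+1 | [&& (i + j == N.+1)%N, (0 < i)%N & (0 < j)%N]) F i j
  = \sum_(i < N.+1) \sum_(j < N.+1 | (i + j == N.+1)%N) F i j.
Proof.
apply: eq_bigr => i _; apply: eq_bigl => j.
case: eqP => //= ij; have := ltn_ord i; have := ltn_ord j.
by case: (val i) (val j) ij => [|i'] [|j'] //=; rewrite ?add0n ?addn0 => ->;
  rewrite ltnn.
Qed.

Let m0 : m ord0 = bracket A. Proof. by case: (deformationP D). Qed.
Let p0 : p ord0 = der A. Proof. by case: (deformationP D). Qed.

Let mlin_sumE n I r (P : pred I) (F : I -> mlin n) x :
  (\sum_(i <- r | P i) F i) x = \sum_(i <- r | P i) F i x.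
Proof. exact: (big_morph (fun f : mlin n => f x)). Qed.

Let Ob2E x y : Ob2 D [tuple x; y] =
  \sum_(a < N.+1) \sum_(b < N.+1 | (a + b == N.+1)%N) brak12_at (p a) (m b) x y.
Proof.
rewrite /Ob2 sum_pos mlin_sumE; apply: eq_bigr => a _.
by rewrite mlin_sumE.
Qed.

Hypothesis K0 : [pchar K] =i pred0.

Let Ob3E x y z : Ob3 D [tuple x; y; z] =
  \sum_(a < N.+1) \sum_(b < N.+1 | (a + b == N.+1)%N)
    circ_at (m a) (m b) x y z.
Proof.
have two0 : 2 != 0 :> K.
  by have := K0 2; rewrite !inE /= => /negbT.
rewrite /Ob3 sum_pos.
have -> : \sum_(i < N.+1) \sum_(j < N.+1 | (i + j == N.+1)%N)
            brak22 (m i) (m j) =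
  2 *: \sum_(i < N.+1) \sum_(j < N.+1 | (i + j == N.+1)%N) circ (m i) (m j).
  rewrite scaler_nat mulr2n [X in _ = _ + X](exchange_big_dep xpredT) //=.
  rewrite -big_split; apply: eq_bigr => i _ /=.
  under [X in _ = _ + X]eq_bigl => j do rewrite addnC.
  by rewrite -big_split.
rewrite scalerA mulVf // scale1r mlin_sumE; apply: eq_bigr => a _.
by rewrite mlin_sumE.
Qed.

Let sum_dep0 (F : 'I_N.+1 -> nat -> g) :
  (forall a k, (k < N.+1)%N -> F a k = 0) ->
  \sum_(a < N.+1) F a (N.+1 - a)%N = F ord0 N.+1.
Proof.
move=> F0; rewrite big_ord_recl subn0 big1 ?addr0 // => i _.
by rewrite F0 // lift0 subSS ltnS leq_subr.
Qed.

Let eq_sub_ord (a : 'I_N.+1) b c :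
  (b + c == N.+1 - a)%N = (a + b + c == N.+1)%N.
Proof. by rewrite -(eqn_add2l a) subnKC 1?ltnW // addnA. Qed.

Let deltaL_Ob3 : deltaL (bracket A) (Ob3 D) = 0.
Proof.
apply/val_inj/funext => t; rewrite (tuple4E t).
set x1 := t`_0; set x2 := t`_1; set x3 := t`_2; set x4 := t`_3.
rewrite [LHS]deltaLE3 -m0.
have -> : (fun x y z => Ob3 D [tuple x; y; z]) = (fun x y z =>
    \sum_(b < N.+1) \sum_(c < N.+1 | (b + c == N.+1)%N)
      circ_at (m b) (m c) x y z).
  by do 3 (apply: funext => ?); rewrite Ob3E.
rewrite -(sum_dep0 (F := fun a k => deltaL3 (m a) (fun x y z =>
  \sum_(b < N.+1) \sum_(c < N.+1 | (b + c == k)%N) circ_at (m b) (m c) x y z)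
  x1 x2 x3 x4)); last first.
  move=> a k kN; rewrite /deltaL3 !leibniz_coef // !raddf0 !app20l.
  by rewrite !(subr0, addr0).
rewrite -[RHS](S3_deltaL3 N.+1 m x1 x2 x3 x4).
apply: eq_bigr => a _; rewrite deltaL3_sum; apply: eq_bigr => b _.
by rewrite deltaL3_sum; apply: eq_bigl => c; rewrite eq_sub_ord.
Qed.

Let deltaL_Ob2 : deltaL (bracket A) (Ob2 D) = delta (der A) (Ob3 D).
Proof.
apply/val_inj/funext => t; rewrite (tuple3E t).
set x1 := t`_0; set x2 := t`_1; set x3 := t`_2.
rewrite [LHS]deltaLE2 [RHS]deltaE3 -m0 -p0.
have -> : (fun x y z => Ob3 D [tuple x; y; z]) = (fun x y z =>
    \sum_(b < N.+1) \sum_(c < N.+1 | (b + c == N.+1)%N)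
      circ_at (m b) (m c) x y z).
  by do 3 (apply: funext => ?); rewrite Ob3E.
have -> : (fun x y => Ob2 D [tuple x; y]) = (fun x y =>
    \sum_(a < N.+1) \sum_(b < N.+1 | (a + b == N.+1)%N)
      brak12_at (p a) (m b) x y).
  by do 2 (apply: funext => ?); rewrite Ob2E.
rewrite -(sum_dep0 (F := fun a k => delta3 (p a) (fun x y z =>
  \sum_(b < N.+1) \sum_(c < N.+1 | (b + c == k)%N) circ_at (m b) (m c) x y z)
  x1 x2 x3)); last first.
  move=> a k kN; rewrite /delta3 !leibniz_coef // raddf0.
  by rewrite !(subr0, addr0).
rewrite -(sum_dep0 (F := fun c k => deltaL2 (m c) (fun x y =>
  \sum_(a < N.+1) \sum_(b < N.+1 | (a + b == k)%N) brak12_at (p a) (m b) x y)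
  x1 x2 x3)); last first.
  move=> a k kN; rewrite /deltaL2 !derivation_coef // !raddf0 !app20l.
  by rewrite !(subr0, addr0).
apply/eqP; rewrite -subr_eq0; apply/eqP.
rewrite -[RHS](S3_deltaL2 N.+1 m p x1 x2 x3).
have S3B F G : S3 N.+1 (fun a b c : 'I_N.+1 => F a b c - G a b c) =
    S3 N.+1 F - S3 N.+1 G.
  rewrite /S3 -sumrB; apply: eq_bigr => a _; rewrite -sumrB.
  by apply: eq_bigr => b _; rewrite -sumrB.
rewrite S3B; congr (_ - _); last first.
  apply: eq_bigr => a _; rewrite delta3_sum; apply: eq_bigr => b _.
  by rewrite delta3_sum; apply: eq_bigl => c; rewrite eq_sub_ord.
rewrite S3_swap23 S3_swap12.
apply: eq_bigr => c _; rewrite deltaL2_sum; apply: eq_bigr => a _.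
by rewrite deltaL2_sum; apply: eq_bigl => b; rewrite eq_sub_ord.
Qed.

Lemma Ob_cocycle : Ob D \in @cocycle_pred K g A 3.
Proof.
apply/eqP; rewrite /pd /= deltaL_Ob3 deltaL_Ob2 signsE scaleN1r subrr.
by [].
Qed.

Definition obstruction_class : cohomology A 3 := cohom_class (Cocycle Ob_cocycle).

End ObstructionCocycle.
End Deformations.

(* Main.v *)
Require Import Defs.
From mathcomp Require Import all_boot all_order all_algebra.
From mathcomp Require Import ring_quotient boolp.
Import GRing.Theory.
Local Open Scope ring_scope.

Set Implicit Arguments.
Unset Strict Implicit.
Unset Printing Implicit Defensive.

(** Extending the deformation by a 2-cochain c = (m', p') imposes only one new
    condition on each structure: the coefficient of t^(N+1) in the Leibniz
    identity and in the derivation identity. Both turn out to be the two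
    components of the single equation [pd A c = Ob D], so that the extensions
    of the deformation are exactly the cochains bounding its obstruction
    cocycle; the theorem follows at once.

    Three facts carry this. First, K[[t]]/(t^(N+1))-bilinearity reduces the
    two identities, a priori about arbitrary truncated series, to monomials
    t^n x, hence to the vanishing for every k <= N of the sums over a + b = k
    of [circ (m a) (m b)] and of [brak12 (p a) (m b)] ([leibniz_tbracketP],
    [derivation_tderP]). Second, appending t^(N+1) m' and t^(N+1) p' leaves
    these sums alone for k <= N, while for k = N+1 it adds to the obstruction
    the two terms in which an index vanishes ([conv_textend_eq0]). Third,
    those terms are differentials up to sign: [brak22] with the bracket is
    - deltaL, and [brak12] is - deltaL in its first argument and - delta in
    its second ([deltaL_brak22], [deltaL_brak12], [delta_brak12]). *)

(** * Convolution sums *)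

Lemma sum_conv_ltn (V : zmodType) M k (F : 'I_M.+1 -> 'I_M.+1 -> V) :
  (k < M)%N ->
  \sum_(a < M.+1) \sum_(b < M.+1 | (a + b == k)%N) F a b
  = \sum_(a < M) \sum_(b < M | (a + b == k)%N)
      F (widen_ord (leqnSn M) a) (widen_ord (leqnSn M) b).
Proof.
move=> kM; rewrite big_ord_recr /= [X in _ + X]big1 ?addr0 => [|b /eqP E].
  apply: eq_bigr => a _.
  by rewrite big_mkcond big_ord_recr /= gtn_eqF ?addr0 -?big_mkcond //
     (leq_trans kM) ?leq_addl.
by move: kM; rewrite -E ltnNge leq_addr.
Qed.

(** Isolates the two corners, where an appended coefficient meets a constant
    one, from the pairs that make up the obstruction. *)
Lemma sum_conv_top (V : zmodType) N (F : 'I_N.+2 -> 'I_N.+2 -> V) :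
  \sum_(a < N.+2) \sum_(b < N.+2 | (a + b == N.+1)%N) F a b
  = \sum_(a < N.+1) \sum_(b < N.+1 | [&& (a + b == N.+1)%N, (0 < a)%N & (0 < b)%N])
      F (widen_ord (leqnSn N.+1) a) (widen_ord (leqnSn N.+1) b)
    + (F ord0 ord_max + F ord_max ord0).
Proof.
rewrite big_ord_recr /= addrA; congr (_ + _); last first.
  by apply: big_pred1 => b; rewrite -[X in _ == X]addn0 eqn_add2l.
(* The last column meets the antidiagonal a + b = N.+1 only in the row a = 0. *)
rewrite (_ : F ord0 ord_max = \sum_(a < N.+1 | a == ord0)
    F (widen_ord (leqnSn N.+1) a) ord_max); last first.
  by rewrite big_pred1_eq; congr F; apply: val_inj.
rewrite [X in _ + X]big_mkcond -big_split; apply: eq_bigr => a _ /=.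
rewrite [LHS]big_mkcond big_ord_recr -big_mkcond /=; congr (_ + _); last first.
  by rewrite -[X in _ == X]add0n eqn_add2r.
apply: eq_bigl => b; case: eqP => //= ab.
have := ltn_ord a; have := ltn_ord b.
by case: (val a) (val b) ab => [|?] [|?] //=; rewrite ?add0n ?addn0 => ->;
  rewrite ltnn.
Qed.

(** * Low-degree differentials as brackets *)

Section Differential.
Variables (K : fieldType) (g : lmodType K).
Implicit Types (m f : mlin g 2) (p : mlin g 1).

Lemma tuple2E (t : 2.-tuple g) : t = [tuple t`_0; t`_1].
Proof. by apply: eq_from_tnth => -[[|[|//]] j]; rewrite (tnth_nth 0). Qed.

Lemma tdrop2l (x y : g) : tdrop ord0 [tuple x; y] = [tuple y].
Proof. by apply: eq_from_tnth => i; rewrite (ord1 i) !tnth_mktuple. Qed.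

Lemma tdrop2r (x y : g) : tdrop ord_max [tuple x; y] = [tuple x].
Proof. by apply: eq_from_tnth => i; rewrite (ord1 i) !tnth_mktuple. Qed.

Let ord2_lift : lift ord0 ord0 = ord_max :> 'I_2.
Proof. exact: val_inj. Qed.

Lemma deltaL_brak22 m f : deltaL m f = - brak22 m f.
Proof.
apply/val_inj/funext => t; rewrite (tuple3E t) [LHS]deltaLE2.
transitivity (- (circ_at m f t`_0 t`_1 t`_2 + circ_at f m t`_0 t`_1 t`_2)) => //.
rewrite /deltaL2 /circ_at !(opprD, opprK) !addrA; do 3 congr (_ + _).
by rewrite [LHS]addrC (addrC (app2 m _ _)) addrA.
Qed.

Lemma deltaL_brak12 m p : deltaL m p = - brak12 p m.
Proof.
apply/val_inj/funext => t; rewrite (tuple2E t).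
set x := t`_0; set y := t`_1.
transitivity (- brak12_at p m x y) => //; rewrite /brak12_at.
rewrite /= /deltaL_fun !big_mkcond /=.
do !rewrite ?[\sum_(i < 2 | _) _]big_mkcond ?big_ord_recl ?big_ord0 /=.
rewrite ord2_lift -tset2l tdrop2l !tdrop2r !(tnth_nth 0) /= !signsE.
rewrite scaleN1r scale1r !(add0r, addr0) !(opprD, opprK).
by rewrite addrC [X in _ + X]addrC addrA.
Qed.

Lemma delta_brak12 m p : delta p m = - brak12 p m.
Proof.
apply/val_inj/funext => t; rewrite (tuple2E t).
set x := t`_0; set y := t`_1.
transitivity (- brak12_at p m x y) => //; rewrite /brak12_at.
rewrite /= /delta_fun !big_ord_recl big_ord0 /= ord2_lift -tset2l -tset2r.
by rewrite addr0 !(opprD, opprK) addrC addrA !(tnth_nth 0).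
Qed.

End Differential.

(** * Bracket and derivation identities, coefficient by coefficient *)

Section Monomials.
Variables (K : fieldType) (g : lmodType K) (N : nat).
Implicit Types (m : trunc N (mlin g 2)) (p : trunc N (mlin g 1)).
Implicit Types (X Y Z : trunc N g) (x y z : g).

(** t^n x, hence 0 when n > N; leaving n unbounded spares every product of
    monomials a case distinction on truncation. *)
Definition monomial n x : trunc N g :=
  [ffun k : 'I_N.+1 => if k == n :> nat then x else 0].

Lemma monomial_sum X : X = \sum_(i < N.+1) monomial i (X i).
Proof.
apply/ffunP => k; rewrite sum_ffunE.
rewrite (bigD1 k) //= ffunE eqxx big1 ?addr0 // => i ik.
by rewrite ffunE eq_sym ifN.
Qed.

Lemma monomialB n x y : monomial n (x - y) = monomial n x - monomial n y.
Proof. by apply/ffunP => k; rewrite !ffunE; case: eqP; rewrite ?subr0. Qed.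

(** This is how an identity between multiadditive expressions is reduced to
    monomials, one argument at a time. *)
Lemma eq0_on_monomials (V : zmodType) (F : trunc N g -> V) :
  {morph F : X Y / X + Y} -> (forall n x, F (monomial n x) = 0) ->
  forall X, F X = 0.
Proof.
move=> FD F0 X; rewrite (monomial_sum X).
rewrite (big_morph F FD (_ : F 0 = 0)); first by rewrite big1.
by apply: (addIr (F 0)); rewrite -FD !add0r.
Qed.

Lemma tbracketDl m Y : {morph tbracket m ^~ Y : X X' / X + X'}.
Proof.
move=> X X'; apply/ffunP => k; rewrite !ffunE -big_split.
apply: eq_bigr => a _; rewrite -big_split; apply: eq_bigr => b _.
by rewrite -big_split; apply: eq_bigr => c _; rewrite ffunE app2Dl.
Qed.

Lemma tbracketDr m X : {morph tbracket m X : Y Y' / Y + Y'}.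
Proof.
move=> Y Y'; apply/ffunP => k; rewrite !ffunE -big_split.
apply: eq_bigr => a _; rewrite -big_split; apply: eq_bigr => b _.
by rewrite -big_split; apply: eq_bigr => c _; rewrite ffunE raddfD.
Qed.

Lemma tderD p : {morph tder p : X Y / X + Y}.
Proof.
move=> X Y; apply/ffunP => k; rewrite !ffunE -big_split.
apply: eq_bigr => a _; rewrite -big_split; apply: eq_bigr => b _.
by rewrite ffunE raddfD.
Qed.

Lemma tbracket_suml m Y I r (P : pred I) (F : I -> trunc N g) :
  tbracket m (\sum_(i <- r | P i) F i) Y
  = \sum_(i <- r | P i) tbracket m (F i) Y.
Proof.
apply: (big_morph _ (tbracketDl m Y)).
by apply: (addIr (tbracket m 0 Y)); rewrite -tbracketDl !add0r.
Qed.

Lemma tbracket_sumr m X I r (P : pred I) (F : I -> trunc N g) :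
  tbracket m X (\sum_(i <- r | P i) F i)
  = \sum_(i <- r | P i) tbracket m X (F i).
Proof.
apply: (big_morph _ (tbracketDr m X)).
by apply: (addIr (tbracket m X 0)); rewrite -tbracketDr !add0r.
Qed.

Lemma tder_sum p I r (P : pred I) (F : I -> trunc N g) :
  tder p (\sum_(i <- r | P i) F i) = \sum_(i <- r | P i) tder p (F i).
Proof.
apply: (big_morph _ (tderD p)).
by apply: (addIr (tder p 0)); rewrite -tderD !add0r.
Qed.

(** The bound on P discards a monomial t^n x with n > N, which is 0. *)
Lemma sum_monomial (F : g -> g) (P : pred nat) n x : F 0 = 0 ->
  (forall c, P c -> (c < N.+1)%N) ->
  \sum_(c < N.+1 | P c) F (monomial n x c) = if P n then F x else 0.
Proof.
move=> F0 Pb; case: ifPn => [Pn | nPn].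
  rewrite (bigD1 (Ordinal (Pb n Pn))) //= ffunE eqxx big1 ?addr0 // => c.
  by case/andP=> _ cn; rewrite ffunE ifN.
rewrite big1 // => c Pc; rewrite ffunE; case: eqP => // cn.
by rewrite -cn Pc in nPn.
Qed.

Let app20l (a : mlin g 2) z : app2 a 0 z = 0.
Proof. by have := app2Zl a 0 0 z; rewrite !scale0r. Qed.

Lemma tbracket_monomial m i j x y :
  tbracket m (monomial i x) (monomial j y)
  = \sum_(a < N.+1) monomial (a + i + j) (app2 (m a) x y).
Proof.
apply/ffunP => k; rewrite sum_ffunE ffunE; apply: eq_bigr => a _.
have ltk n c : (n + c == k)%N -> (c < N.+1)%N.
  by move/eqP=> E; apply: leq_trans (ltn_ord k); rewrite ltnS -E leq_addl.
under eq_bigr => b _ do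
  rewrite (sum_monomial (F := app2 (m a) _) (P := fun c => (a + b + c)%N == k)
             j y (raddf0 _) (ltk _)).
rewrite -big_mkcond (sum_monomial (F := app2 (m a) ^~ y)
  (P := fun b => (a + b + j)%N == k) i x (app20l _ _)) => [|c].
  by rewrite ffunE eq_sym.
by rewrite addnAC; apply: ltk.
Qed.

Lemma tder_monomial p i x :
  tder p (monomial i x) = \sum_(a < N.+1) monomial (a + i) (app1 (p a) x).
Proof.
apply/ffunP => k; rewrite sum_ffunE ffunE; apply: eq_bigr => a _.
rewrite (sum_monomial (P := fun b => (a + b)%N == k) i x (raddf0 _)) => [|c].
  by rewrite ffunE eq_sym.
by move/eqP=> E; apply: leq_trans (ltn_ord k); rewrite ltnS -E leq_addl.
Qed.

Lemma mlin_sumE n I r (P : pred I) (F : I -> mlin g n) t :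
  (\sum_(i <- r | P i) F i) t = \sum_(i <- r | P i) F i t.
Proof. exact: (big_morph (fun f : mlin g n => f t)). Qed.

Lemma conv_monomial (F : 'I_N.+1 -> 'I_N.+1 -> g) s (k : 'I_N.+1) :
  (\sum_(a < N.+1) \sum_(b < N.+1) monomial (a + b + s) (F a b)) k
  = \sum_(a < N.+1) \sum_(b < N.+1 | (a + b + s == k)%N) F a b.
Proof.
rewrite sum_ffunE; apply: eq_bigr => a _.
rewrite sum_ffunE [RHS]big_mkcond; apply: eq_bigr => b _.
by rewrite ffunE eq_sym.
Qed.

(** If all coefficients up to t^N of a convolution vanish, so do all those of
    its product by t^s: they are the same ones, shifted, with those past t^N
    dropped. *)
Lemma conv_monomial_eq0 n (F : 'I_N.+1 -> 'I_N.+1 -> mlin g n) t s :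
  (forall k : 'I_N.+1,
     \sum_(a < N.+1) \sum_(b < N.+1 | (a + b == k)%N) F a b = 0) ->
  \sum_(a < N.+1) \sum_(b < N.+1) monomial (a + b + s) (F a b t) = 0.
Proof.
move=> F0; apply/ffunP => k; rewrite conv_monomial ffunE.
have [sk|ks] := leqP s k; last first.
  rewrite big1 // => a _; rewrite big_pred0 // => b.
  by rewrite gtn_eqF // (leq_trans ks) ?leq_addl.
have kN : (k - s < N.+1)%N by apply: leq_ltn_trans (ltn_ord k); apply: leq_subr.
have /(congr1 (fun f : mlin g n => f t)) := F0 (Ordinal kN).
rewrite mlin_sumE => E; apply: etrans E; apply: eq_bigr => a _.
rewrite mlin_sumE; apply: eq_bigl => b /=.
by rewrite -[in LHS](subnK sk) eqn_add2r.
Qed.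

(** On monomials the power of t factors out of the Leibniz defect, leaving the
    convolution of [circ] at the coefficients. *)
Lemma circ_monomial m i j l x y z :
  tbracket m (tbracket m (monomial i x) (monomial j y)) (monomial l z)
  - tbracket m (tbracket m (monomial i x) (monomial l z)) (monomial j y)
  - tbracket m (monomial i x) (tbracket m (monomial j y) (monomial l z))
  = \sum_(a < N.+1) \sum_(b < N.+1)
      monomial (a + b + (i + j + l)) (circ (m a) (m b) [tuple x; y; z]).
Proof.
rewrite !tbracket_monomial !tbracket_suml tbracket_sumr.
under eq_bigr => b _ do rewrite tbracket_monomial.
under [X in _ - X - _]eq_bigr => b _ do rewrite tbracket_monomial.
under [X in _ - _ - X]eq_bigr => b _ do rewrite tbracket_monomial.
rewrite exchange_big [X in _ - X - _]exchange_big [X in _ - _ - X]exchange_big.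
rewrite -!sumrB; apply: eq_bigr => a _; rewrite -!sumrB; apply: eq_bigr => b _.
rewrite /= /circ_fun /circ_at !monomialB /=.
congr (monomial _ _ - monomial _ _ - monomial _ _); rewrite !addnA //.
- by rewrite addnAC.
- by rewrite (addnAC a i).
Qed.

Lemma brak12_monomial m p i j x y :
  tder p (tbracket m (monomial i x) (monomial j y))
  - tbracket m (tder p (monomial i x)) (monomial j y)
  - tbracket m (monomial i x) (tder p (monomial j y))
  = \sum_(a < N.+1) \sum_(b < N.+1)
      monomial (a + b + (i + j)) (brak12 (p a) (m b) [tuple x; y]).
Proof.
rewrite !tbracket_monomial !tder_monomial tder_sum tbracket_suml tbracket_sumr.
under eq_bigr => b _ do rewrite tder_monomial.
under [X in _ - X - _]eq_bigr => b _ do rewrite tbracket_monomial.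
under [X in _ - _ - X]eq_bigr => b _ do rewrite tbracket_monomial.
rewrite exchange_big -!sumrB; apply: eq_bigr => a _.
rewrite -!sumrB; apply: eq_bigr => b _.
rewrite /= /brak12_fun /brak12_at !monomialB /=.
congr (monomial _ _ - monomial _ _ - monomial _ _).
- by rewrite !addnA.
- by rewrite !addnA (addnC b).
- by rewrite !addnA (addnAC b) (addnC b).
Qed.

Lemma subr2_eq0 (V : zmodType) (x y z : V) : x - y - z = 0 <-> x = y + z.
Proof. by rewrite -addrA -opprD; split=> [/subr0_eq | ->] //; rewrite subrr. Qed.

(** Constant series give the coefficients; conversely the Leibniz defect is
    additive in each argument, hence vanishes once it does on monomials. *)
Lemma leibniz_tbracketP m : leibniz (tbracket m) <->
  forall k : 'I_N.+1,
    \sum_(a < N.+1) \sum_(b < N.+1 | (a + b == k)%N) circ (m a) (m b) = 0.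
Proof.
split=> [L k | H X Y Z].
  apply/val_inj/funext => t; rewrite (tuple3E t).
  set x := t`_0; set y := t`_1; set z := t`_2.
  have /subr2_eq0 := L (monomial 0 x) (monomial 0 y) (monomial 0 z).
  rewrite circ_monomial => /ffunP/(_ k); rewrite conv_monomial ffunE => E.
  apply: etrans E; rewrite [LHS]mlin_sumE; apply: eq_bigr => a _.
  by rewrite mlin_sumE; apply: eq_bigl => b; rewrite !addn0.
apply/subr2_eq0; move: X.
apply: eq0_on_monomials => [X X'|i x]; first by rewrite !tbracketDl addrBB.
move: Y; apply: eq0_on_monomials => [Y Y'|j y].
  by rewrite !(tbracketDl, tbracketDr) addrBB.
move: Z; apply: eq0_on_monomials => [Z Z'|l z].
  by rewrite !(tbracketDl, tbracketDr) addrBB.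
by rewrite circ_monomial conv_monomial_eq0.
Qed.

Lemma derivation_tderP m p : derivation (tbracket m) (tder p) <->
  forall k : 'I_N.+1,
    \sum_(a < N.+1) \sum_(b < N.+1 | (a + b == k)%N) brak12 (p a) (m b) = 0.
Proof.
split=> [L k | H X Y].
  apply/val_inj/funext => t; rewrite (tuple2E t).
  set x := t`_0; set y := t`_1.
  have /subr2_eq0 := L (monomial 0 x) (monomial 0 y).
  rewrite brak12_monomial => /ffunP/(_ k); rewrite conv_monomial ffunE => E.
  apply: etrans E; rewrite [LHS]mlin_sumE; apply: eq_bigr => a _.
  by rewrite mlin_sumE; apply: eq_bigl => b; rewrite !addn0.
apply/subr2_eq0; move: X.
apply: eq0_on_monomials => [X X'|i x].
  by rewrite !(tbracketDl, tderD) addrBB.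
move: Y; apply: eq0_on_monomials => [Y Y'|j y].
  by rewrite !(tbracketDr, tderD) addrBB.
by rewrite brak12_monomial conv_monomial_eq0.
Qed.

End Monomials.

(** * Extensions and the obstruction *)

Section Extension.
Variables (K : fieldType) (charK : [pchar K] =i pred0) (g : lmodType K).
Variables (A : leibDerPair g) (N : nat) (D : deformation A N).

Lemma textend_widen V (x : trunc N V) v i :
  textend x v (widen_ord (leqnSn N.+1) i) = x i.
Proof.
rewrite ffunE; have -> : widen_ord (leqnSn N.+1) i = lift ord_max i.
  by apply: val_inj; rewrite /= /bump leqNgt ltn_ord.
by rewrite liftK.
Qed.

Lemma textend_max V (x : trunc N V) v : textend x v ord_max = v.
Proof. by rewrite ffunE unlift_none. Qed.

Lemma textend0 V (x : trunc N V) v : textend x v ord0 = x ord0.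
Proof. by rewrite -(textend_widen x v); congr (textend _ _ _); apply: val_inj. Qed.

(** [brak22] is the symmetrization of [circ], so that summing it over all pairs
    counts each [circ] twice. *)
Lemma Ob3E : Ob3 D = \sum_(i < N.+1)
  \sum_(j < N.+1 | [&& (i + j == N.+1)%N, (0 < i)%N & (0 < j)%N])
    circ (mut D i) (mut D j).
Proof.
have two0 : 2 != 0 :> K.
  by have := charK 2; rewrite !inE /= => /negbT.
rewrite -[RHS]scale1r -(mulVf two0) -scalerA /Ob3; congr (_ *: _).
rewrite scaler_nat mulr2n [X in _ = _ + X](exchange_big_dep xpredT) //=.
rewrite -big_split; apply: eq_bigr => i _ /=.
under [X in _ = _ + X]eq_bigl => j do rewrite addnC (andbC (0 < j)%N).
by rewrite -big_split.
Qed.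

(** Only the coefficient of t^(N+1) constrains an extension: an appended term
    has degree N+1 and cannot contribute below it. *)
Lemma conv_textend_eq0 (U V W : zmodType) (F : U -> V -> W)
    (X : trunc N U) (Y : trunc N V) u v :
  (forall k : 'I_N.+1,
     \sum_(a < N.+1) \sum_(b < N.+1 | (a + b == k)%N) F (X a) (Y b) = 0) ->
  (forall k : 'I_N.+2,
     \sum_(a < N.+2) \sum_(b < N.+2 | (a + b == k)%N)
       F (textend X u a) (textend Y v b) = 0) <->
  \sum_(a < N.+1)
    \sum_(b < N.+1 | [&& (a + b == N.+1)%N, (0 < a)%N & (0 < b)%N])
      F (X a) (Y b) + (F (X ord0) v + F u (Y ord0)) = 0.
Proof.
move=> F0; set R := (X in _ <-> X = 0).
have topE : \sum_(a < N.+2) \sum_(b < N.+2 | (a + b == N.+1)%N)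
    F (textend X u a) (textend Y v b) = R.
  rewrite sum_conv_top !textend0 !textend_max; congr (_ + _).
  by apply: eq_bigr => a _; apply: eq_bigr => b _; rewrite !textend_widen.
rewrite -topE; split=> [/(_ ord_max) //| top k].
case: (unliftP ord_max k) => [i ->|->] //.
have -> : nat_of_ord (lift ord_max i) = i by rewrite /= /bump leqNgt ltn_ord.
rewrite sum_conv_ltn // -[RHS](F0 i).
by apply: eq_bigr => a _; apply: eq_bigr => b _; rewrite !textend_widen.
Qed.

(** The Leibniz and derivation conditions in degree N+1 read Ob3 - deltaL m' = 0
    and Ob2 - (deltaL p' + delta m') = 0. *)
Lemma deformation_textendP (c : cochain g 2) :
  is_deformation A (textend (mut D) c.1) (textend (phit D) c.2) <->
  pd A c = Ob D.
Proof.
case: (deformationP D) => m0 p0 /leibniz_tbracketP mL /derivation_tderP pD.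
have E3 : deltaL (bracket A) c.1 = Ob3 D <->
    leibniz (tbracket (textend (mut D) c.1)).
  apply: iff_trans (iff_sym (leibniz_tbracketP _)).
  apply: iff_trans (iff_sym (conv_textend_eq0 _ _ mL)).
  rewrite -Ob3E m0 -[X in _ + X]opprK -deltaL_brak22.
  by split=> [->|/subr0_eq ->] //; rewrite subrr.
have E2 : deltaL (bracket A) c.2 + delta (der A) c.1 = Ob2 D <->
    derivation (tbracket (textend (mut D) c.1)) (tder (textend (phit D) c.2)).
  apply: iff_trans (iff_sym (derivation_tderP _ _)).
  apply: iff_trans (iff_sym (conv_textend_eq0 _ _ pD)).
  rewrite m0 p0 -[brak12 _ _ + _]opprK opprD -delta_brak12 -deltaL_brak12.
  by rewrite (addrC (delta _ _)); split=> [->|/subr0_eq <-] //; rewrite subrr.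
have -> : pd A c = (deltaL (bracket A) c.1,
                    deltaL (bracket A) c.2 + delta (der A) c.1).
  by rewrite /pd signsE scale1r.
split=> [[_ _ L d]|E]; first by rewrite (proj2 E3 L) (proj2 E2 d).
split; rewrite ?textend0 //; first exact/E3/(congr1 (@fst _ _) E).
exact/E2/(congr1 (@snd _ _) E).
Qed.

Lemma obstruction_class_eq0 :
  obstruction_class D charK = 0 <-> is_coboundary A (Ob D).
Proof.
rewrite /obstruction_class /cohom_class; set c := Cocycle _.
have -> : 0 = (\pi_(Quotient.quot (@coboundary K g A 3)) 0)%qT.
  by rewrite raddf0.
split=> [/eqP|cB]; last apply/eqP.
  by rewrite -Quotient.idealrBE subr0 => /asboolP.
by rewrite -Quotient.idealrBE subr0; apply/asboolP.
Qed.

End Extension.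

Theorem theorem5p11 (K : fieldType) (charK : [pchar K] =i pred0)
    (g : lmodType K) (A : leibDerPair g) (N : nat) (D : deformation A N) :
  extensible D <-> obstruction_class D charK = 0.
Proof.
rewrite obstruction_class_eq0 /=.
by split=> -[c cP]; exists c; apply/deformation_textendP.
Qed.
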